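(* Let $q$ be a prime power and $K=\mathbb{F}_q((t^{-1}))$, let $\mathbb{L}=\{f\in K: |f|<1\}$, and let $\mu$ be the Haar measure on $K$ normalized so that $\mu(\{f\in K:|f|\le 1\})=1$. Let $\mu_G$ be the measure on $\mathbb{L}\times\mathbb{Z}$ defined by: for each measurable $E\subset\mathbb{L}$, $$\mu_G(E\times\{n\})=\begin{cases}\dfrac{q-1}{2q^{n}}\,\mu(E), & n\ge 0,\\[2mm] \dfrac{q-1}{2q^{-n-1}}\,\mu(E), & n<0.\end{cases}$$ Then $\mu_G$ is an ergodic invariant measure for the geometric Farey map $F:\mathbb{L}\times\mathbb{Z}\to\mathbb{L}\times\mathbb{Z}$ given by $$F(f,n)=\begin{cases}\left(tf-[tf],\,n+1\right), & \text{if }\deg(f)<-1\text{ or }n<0,\\[1mm] \left(\dfrac{1}{tf}-\left[\dfrac{1}{tf}\right],\,-(n+1)\right), & \text{if }\deg(f)=-1\text{ and }n\ge 0.\end{cases}$$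
   Context: $K=\mathbb{F}_q((t^{-1}))$ is the field of formal Laurent series $f=a_nt^n+\dots+a_1t+a_0+a_{-1}t^{-1}+\cdots$ with $a_i\in\mathbb{F}_q$. For such $f$ with $a_n\ne 0$, $\deg(f)=n$ and $|f|=q^{n}$; by convention $\deg(0)=-\infty$ and $|0|=0$. The polynomial part of $f=\sum_{i\le n}a_it^i$ is $[f]=\sum_{0\le i\le n}a_it^i\in\mathbb{F}_q[t]$. Every element of $\mathbb{L}$ has degree at most $-1$. *)

(* Defs.v *)
From HB Require Import structures.
From mathcomp Require Import all_boot all_order all_algebra.
From mathcomp Require Import all_classical all_reals all_analysis.
From mathcomp Require Import zify.

Set Implicit Arguments.
Unset Strict Implicit.
Unset Printing Implicit Defensive.

Import Order.TTheory GRing.Theory Num.Theory.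
Import numFieldNormedType.Exports.

Local Open Scope classical_set_scope.
Local Open Scope ring_scope.

(* [coefl f i] is the coefficient of [t ^ i]; the series extends towards
   negative exponents. *)
Record laurent (F : finFieldType) := Laurent {
  coefl :> int -> F;
  laurent_bounded : exists N : int, forall i, N < i -> coefl i = 0 }.

HB.instance Definition _ (F : finFieldType) := gen_eqMixin (laurent F).
HB.instance Definition _ (F : finFieldType) := gen_choiceMixin (laurent F).

Section LaurentField.
Variable F : finFieldType.
Implicit Types (a b c : int -> F) (f g h : laurent F) (N M k : int).

Lemma laurentP f g : f =1 g -> f = g.
Proof.
case: f g => [a pa] [b pb] /= /funext eab; subst b.
by rewrite (Prop_irrelevance pa pb).
Qed.

Let bnd N a := forall i, N < i -> a i = 0.

Let bnd_le N M a : N <= M -> bnd N a -> bnd M a.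
Proof. by move=> NM aN i Mi; apply: aN; apply: le_lt_trans Mi. Qed.

Let bnd2 f g : exists N, bnd N f /\ bnd N g.
Proof.
have [N fN] := laurent_bounded f; have [M gM] := laurent_bounded g.
exists (Num.max N M); split.
- by apply: bnd_le fN; rewrite le_max lexx.
- by apply: bnd_le gM; rewrite le_max lexx orbT.
Qed.

Let add_subproof f g : exists N, bnd N (fun i => f i + g i).
Proof. by have [N [fN gN]] := bnd2 f g; exists N => i Ni; rewrite fN// gN// addr0. Qed.

Let opp_subproof f : exists N, bnd N (fun i => - f i).
Proof. by have [N fN] := laurent_bounded f; exists N => i Ni; rewrite fN// oppr0. Qed.

Let monom_subproof (k : int) : exists N, bnd N (fun i => (i == k)%:R).
Proof. by exists k => i ki; rewrite gt_eqF. Qed.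

Let zero_subproof : exists N, bnd N (fun=> 0).
Proof. by exists 0. Qed.

Definition laurent0 := Laurent zero_subproof.
Definition laurent_add f g := Laurent (add_subproof f g).
Definition laurent_opp f := Laurent (opp_subproof f).
(* the monomial [t ^ k] *)
Definition laurentXn k := Laurent (monom_subproof k).

Let addA : associative laurent_add.
Proof. by move=> f g h; apply: laurentP => i /=; rewrite addrA. Qed.
Let addC : commutative laurent_add.
Proof. by move=> f g; apply: laurentP => i /=; rewrite addrC. Qed.
Let add0 : left_id laurent0 laurent_add.
Proof. by move=> f; apply: laurentP => i /=; rewrite add0r. Qed.
Let addN : left_inverse laurent0 laurent_opp laurent_add.
Proof. by move=> f; apply: laurentP => i /=; rewrite addNr. Qed.

HB.instance Definition _ := GRing.isZmodule.Build (laurent F) addA addC add0 addN.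

(* The summand has finite support. *)
Definition laurent_conv a b k : F := \sum_(i \in [set: int]) a i * b (k - i).

Lemma laurent_convE N M a b (n : nat) : bnd N a -> bnd M b ->
  laurent_conv a b (N + M - n%:Z) =
  \sum_(j < n.+1) a (N - j%:Z) * b (M - (n - j)%N%:Z).
Proof.
move=> aN bM; rewrite /laurent_conv.
pose r := [seq N - j%:Z | j <- iota 0 n.+1].
rewrite (@fsbigE _ _ _ _ _ r).
- rewrite big_map big_mkcond/= -[0%N :: _]/(iota 0 n.+1).
  have -> : iota 0 n.+1 = index_iota 0 n.+1 by rewrite /index_iota subn0.
  rewrite big_mkord; apply: eq_bigr => j _; rewrite in_setT.
  by congr (_ * b _); have := ltn_ord j; lia.
- by rewrite map_inj_uniq ?iota_uniq// => i j; lia.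
- by [].
- move=> i _ iN.
  have [Ni|iN'] := ltP N i; first by rewrite aN// mul0r.
  rewrite bM ?mulr0//; rewrite ltNge; apply/negP => le.
  move/negP: iN; apply; apply/mapP; exists `|N - i|%N; last by lia.
  by rewrite mem_iota; lia.
Qed.

Lemma laurent_conv_bnd N M a b : bnd N a -> bnd M b -> bnd (N + M) (laurent_conv a b).
Proof.
move=> aN bM k NMk; rewrite /laurent_conv fsbig1// => i _.
have [Ni|iN] := ltP N i; first by rewrite aN// mul0r.
by rewrite bM ?mulr0//; lia.
Qed.

Let ser N a n : {poly F} := \poly_(i < n.+1) a (N - i%:Z).

Let laurent_convE' N M a b (n m : nat) : bnd N a -> bnd M b -> (n <= m)%N ->
  laurent_conv a b (N + M - n%:Z) = (ser N a m * ser M b m)`_n.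
Proof.
move=> aN bM nm; rewrite (laurent_convE _ aN bM) coefM; apply: eq_bigr => j _.
rewrite !coef_poly !ltnS (leq_trans _ nm) ?(leq_trans _ nm)//.
  exact: leq_subr.
by rewrite -ltnS.
Qed.

Let bndP N k : N < k \/ exists n : nat, k = N - n%:Z.
Proof.
have [|kN] := ltP N k; first by left.
by right; exists `|N - k|%N; lia.
Qed.

Let mul_subproof f g : exists N, bnd N (laurent_conv f g).
Proof.
have [N fN] := laurent_bounded f; have [M gM] := laurent_bounded g.
by exists (N + M); apply: laurent_conv_bnd.
Qed.

Definition laurent_mul f g := Laurent (mul_subproof f g).

Let mulC : commutative laurent_mul.
Proof.
move=> f g; apply: laurentP => k /=.
have [N fN] := laurent_bounded f; have [M gM] := laurent_bounded g.
have [lk|[n ->]] := bndP (N + M) k.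
  by rewrite (laurent_conv_bnd fN gM)// (laurent_conv_bnd gM fN)// addrC.
by rewrite (laurent_convE' fN gM (leqnn n)) mulrC [N + M]addrC (laurent_convE' gM fN (leqnn n)).
Qed.

Let mulA : associative laurent_mul.
Proof.
move=> f g h; apply: laurentP => k /=.
have [N fN] := laurent_bounded f; have [M gM] := laurent_bounded g.
have [P hP] := laurent_bounded h.
have fg := laurent_conv_bnd fN gM; have gh := laurent_conv_bnd gM hP.
have [lk|[n ->]] := bndP (N + M + P) k.
  by rewrite (laurent_conv_bnd fg hP)// (laurent_conv_bnd fN gh)// addrA.
rewrite (laurent_convE' fg hP (leqnn n)).
rewrite (_ : N + M + P - n%:Z = N + (M + P) - n%:Z); last by lia.
rewrite (laurent_convE' fN gh (leqnn n)).
transitivity ((ser N f n * ser M g n * ser P h n)`_n).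
  rewrite -mulrA !coefM; apply: eq_bigr => j _; congr (_ * _).
  by rewrite coef_poly ltnS leq_subr (laurent_convE' gM hP (leq_subr j n)).
rewrite !coefM; apply: eq_bigr => j _; congr (_ * _).
by rewrite [RHS]coef_poly ltn_ord -(laurent_convE' fN gM)// -ltnS.
Qed.

Let mul1 : left_id (laurentXn 0) laurent_mul.
Proof.
move=> f; apply: laurentP => k /=; rewrite /laurent_conv.
rewrite (@fsbigE _ _ _ _ _ [:: 0])//.
- by rewrite big_cons big_nil in_setT eqxx mul1r subr0; exact: addr0.
- by move=> i _; rewrite inE => i0; rewrite (negbTE i0) mul0r.
Qed.

Let mulDl : left_distributive laurent_mul +%R.
Proof.
move=> f g h; apply: laurentP => k.
change (laurent_conv (f + g : laurent F) h k = laurent_conv f h k + laurent_conv g h k).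
have [N [fN gN]] := bnd2 f g; have [P hP] := laurent_bounded h.
have fgN : bnd N (f + g : laurent F) by move=> i Ni /=; rewrite fN// gN// addr0.
have [lk|[n ->]] := bndP (N + P) k.
  by rewrite (laurent_conv_bnd fgN hP)// (laurent_conv_bnd fN hP)// (laurent_conv_bnd gN hP)// addr0.
rewrite (laurent_convE _ fgN hP) (laurent_convE _ fN hP) (laurent_convE _ gN hP) -big_split/=.
by apply: eq_bigr => j _; rewrite mulrDl.
Qed.

Let one_neq0 : laurentXn 0 != 0 :> laurent F.
Proof. by apply/eqP => /(congr1 (fun f => coefl f 0)) /= /eqP; rewrite oner_eq0. Qed.

HB.instance Definition _ := GRing.Zmodule_isComNzRing.Build (laurent F)
  mulA mulC mul1 mulDl one_neq0.

Lemma coefl0 i : (0 : laurent F) i = 0. Proof. by []. Qed.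
Lemma coeflD f g i : (f + g) i = f i + g i. Proof. by []. Qed.
Lemma coeflN f i : (- f) i = - f i. Proof. by []. Qed.
Lemma coeflM f g k : (f * g) k = \sum_(i \in [set: int]) f i * g (k - i).
Proof. by []. Qed.

Lemma laurent_top f : f != 0 ->
  exists n, f n != 0 /\ forall i, n < i -> f i = 0.
Proof.
move=> f0; have [N fN] := laurent_bounded f.
have [n0 fn0] : exists n : nat, f (N - n%:Z) != 0.
  apply: contrapT => /forallNP f0'; move/eqP: f0; apply; apply: laurentP => i.
  have [/fN//|[n ->]] := bndP N i.
  by apply/eqP; apply: contrapT => /negP; apply: f0'.
have ex : exists n : nat, f (N - n%:Z) != 0 by exists n0.
case: (ex_minnP ex) => n fn nmin; exists (N - n%:Z); split => // i ni.
have [/fN//|[m im]] := bndP N i; apply/eqP; apply: contraT.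
by rewrite im => /nmin; lia.
Qed.

(* The list of the first [n] coefficients of the inverse of the power series
   with coefficients [p]. *)
Fixpoint psinv (p : nat -> F) (n : nat) : seq F :=
  if n is n'.+1 then
    let s := psinv p n' in
    rcons s (if n' is 0%N then (p 0%N)^-1 else
             - (p 0%N)^-1 * \sum_(j < n') p (n' - j)%N * s`_j)
  else [::].

Let size_psinv p n : size (psinv p n) = n.
Proof. by elim: n => //= n IH; rewrite size_rcons IH. Qed.

Let psinvE p m n j : (j < m)%N -> (m <= n)%N -> (psinv p n)`_j = (psinv p m)`_j.
Proof.
move=> jm; elim: n => [|n IH]; first by lia.
rewrite leq_eqVlt => /orP[/eqP -> //|mn] /=.
by rewrite nth_rcons size_psinv (leq_trans jm mn) IH.
Qed.

Let psinvP p n : p 0%N != 0 ->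
  \sum_(j < n.+1) (psinv p j.+1)`_j * p (n - j)%N = (n == 0%N)%:R.
Proof.
move=> p0; rewrite big_ord_recr/= subnn nth_rcons size_psinv ltnn eqxx.
case: n => [|n]; first by rewrite big_ord0 add0r mulVf.
rewrite mulrAC mulNr mulVf// mulN1r.
apply/eqP; rewrite subr_eq0; apply/eqP; apply: eq_bigr => j _.
by rewrite mulrC -(@psinvE p j.+1 n.+1).
Qed.

Lemma laurent_inv_ex f : f != 0 -> exists g, g * f = 1.
Proof.
move=> /laurent_top[N [fN0 fN]].
pose p (n : nat) := f (N - n%:Z).
pose b (i : int) : F := if i <= - N then (psinv p `|- N - i|.+1)`_`|- N - i| else 0.
have bN : bnd (- N) b by move=> i Ni; rewrite /b leNgt Ni.
exists (Laurent (ex_intro (fun N => bnd N b) _ bN)); apply: laurentP => k.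
rewrite [LHS]/=.
have [lk|[n kE]] := bndP (- N + N) k.
  rewrite (laurent_conv_bnd bN fN)//=; by rewrite gt_eqF//; lia.
rewrite kE (laurent_convE _ bN fN)/=.
have p0 : p 0%N != 0 by rewrite /p subr0.
transitivity (\sum_(j < n.+1) (psinv p j.+1)`_j * p (n - j)%N).
  apply: eq_bigr => j _; rewrite /b /p; congr (_ * _).
  have -> : - N - j%:Z <= - N by lia.
  by have -> : absz (- N - (- N - j%:Z))%R = j by lia.
rewrite psinvP//; congr (_%:R); congr nat_of_bool; lia.
Qed.

Definition laurent_inv f : laurent F :=
  if f == 0 then 0 else xget 0 [set g | g * f = 1].

Let mulVf f : f != 0 -> laurent_inv f * f = 1.
Proof.
move=> f0; rewrite /laurent_inv (negbTE f0).
by have [g gf] := laurent_inv_ex f0; case: xgetP => [_ _ //|/(_ g)]; move/(_ gf).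
Qed.

Let inv0 : laurent_inv 0 = 0.
Proof. by rewrite /laurent_inv eqxx. Qed.

HB.instance Definition _ := GRing.ComNzRing_isField.Build (laurent F) mulVf inv0.

Definition laurentX : laurent F := laurentXn 1.

Definition laurent_deg f : \bar int :=
  if f == 0 then -oo%E
  else (xget 0 [set n : int | f n != 0 /\ forall i, n < i -> f i = 0])%:E.

Lemma laurent_deg0 : laurent_deg 0 = -oo%E.
Proof. by rewrite /laurent_deg eqxx. Qed.

Lemma laurent_degP f n :
  laurent_deg f = n%:E <-> f n != 0 /\ forall i, n < i -> f i = 0.
Proof.
rewrite /laurent_deg; have [->|f0] := eqVneq f 0.
  by split => [//|[]]; rewrite coefl0 eqxx.
case: xgetP => [m _ [fm mP]|/(_ _)nP]; last first.
  by have [m /nP] := laurent_top f0.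
split => [[<-]//|[fn nP]]; congr (_%:E).
have [mn|nm|//] := ltgtP m n.
- by rewrite mP ?eqxx in fn.
- by rewrite nP ?eqxx in fm.
Qed.

(* The absolute value only takes rational values. *)
Definition laurent_abs f : rat :=
  if laurent_deg f is n%:E then #|F|%:R ^ n else 0.

Let q_gt1 : 1 < #|F|%:R :> rat.
Proof. by rewrite ltr1n card_finNzRing_gt1. Qed.

Let q_gt0 : 0 < #|F|%:R :> rat.
Proof. exact: lt_trans q_gt1. Qed.

Lemma laurent_abs0 : laurent_abs 0 = 0.
Proof. by rewrite /laurent_abs laurent_deg0. Qed.

Lemma laurent_abs_ge0 f : 0 <= laurent_abs f.
Proof. by rewrite /laurent_abs; case: laurent_deg => // n; rewrite exprz_ge0// ltW. Qed.

Lemma laurent_abs_leP f n :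
  laurent_abs f <= #|F|%:R ^ n <-> forall i, n < i -> f i = 0.
Proof.
have [->|f0] := eqVneq f 0.
  by rewrite laurent_abs0 exprz_ge0// ltW.
have [m mP] := laurent_top f0; have /laurent_degP fm := mP.
rewrite /laurent_abs fm ler_eXz2l//; case: mP => fm0 mP; split.
- by move=> mn i ni; apply: mP; apply: le_lt_trans ni.
- by move=> nP; rewrite leNgt; apply: contra fm0 => /nP ->.
Qed.

Lemma laurent_abs_ltP f n :
  laurent_abs f < #|F|%:R ^ n <-> forall i, n <= i -> f i = 0.
Proof.
have [->|f0] := eqVneq f 0.
  by rewrite laurent_abs0 exprz_gt0.
have [m mP] := laurent_top f0; have /laurent_degP fm := mP.
rewrite /laurent_abs fm ltr_eXz2l//; case: mP => fm0 mP; split.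
- by move=> mn i ni; apply: mP; apply: lt_le_trans ni.
- by move=> nP; rewrite ltNge; apply: contra fm0 => /nP ->.
Qed.

Lemma laurent_abs_lt1P f : laurent_abs f < 1 <-> forall i, 0 <= i -> f i = 0.
Proof. exact: (laurent_abs_ltP f 0). Qed.

Lemma laurent_absN f : laurent_abs (- f) = laurent_abs f.
Proof.
have [->|f0] := eqVneq f 0; first by rewrite oppr0.
have [m mP] := laurent_top f0; have /laurent_degP fm := mP.
have /laurent_degP Nfm : (- f) m != 0 /\ forall i, m < i -> (- f) i = 0.
  by case: mP => fm0 mP; rewrite coeflN oppr_eq0; split => // i /mP;
    rewrite coeflN => ->; rewrite oppr0.
by rewrite /laurent_abs fm Nfm.
Qed.

Lemma laurent_absD f g :
  laurent_abs (f + g) <= Num.max (laurent_abs f) (laurent_abs g).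
Proof.
have [->|f0] := eqVneq f 0; first by rewrite add0r le_max lexx orbT.
have [->|g0] := eqVneq g 0; first by rewrite addr0 le_max lexx.
have [m mP] := laurent_top f0; have /laurent_degP fm := mP.
have [n nP] := laurent_top g0; have /laurent_degP gn := nP.
suff H : laurent_abs (f + g) <= #|F|%:R ^ (Num.max m n).
  apply: le_trans H _; rewrite {1}/Num.max; case: ifP => _;
  by rewrite le_max /laurent_abs fm gn lexx ?orbT.
apply/laurent_abs_leP => i; rewrite gt_max => /andP[mi ni].
by rewrite coeflD mP.2// nP.2// addr0.
Qed.

Definition laurent_ball f (e : rat) g : Prop := laurent_abs (f - g) < e.

Lemma laurent_ball_center f (e : rat) : 0 < e -> laurent_ball f e f.
Proof. by rewrite /laurent_ball subrr laurent_abs0. Qed.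

Lemma laurent_ball_sym f g (e : rat) : laurent_ball f e g -> laurent_ball g e f.
Proof. by rewrite /laurent_ball -opprB laurent_absN. Qed.

Lemma laurent_ball_triangle f g h (e1 e2 : rat) :
  laurent_ball f e1 g -> laurent_ball g e2 h -> laurent_ball f (e1 + e2) h.
Proof.
rewrite /laurent_ball => fg gh; rewrite -(subrK g f) -addrA.
apply: le_lt_trans (laurent_absD _ _) _.
apply: (@le_lt_trans _ _ (laurent_abs (f - g) + laurent_abs (g - h))).
  by rewrite ge_max lerDl lerDr !laurent_abs_ge0.
exact: ltrD.
Qed.

HB.instance Definition _ := hasNbhs.Build (laurent F)
  (nbhs_ (entourage_ laurent_ball)).
HB.instance Definition _ := Nbhs_isPseudoMetric.Build rat (laurent F)
  erefl laurent_ball_center laurent_ball_sym laurent_ball_triangle erefl.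

HB.instance Definition _ := isPointed.Build (laurent F) 0.

HB.instance Definition _ := Measurable.copy (laurent F)
  (g_sigma_algebraType (@open (laurent F))).

Let polypart_subproof f : exists N, bnd N (fun i => if 0 <= i then f i else 0).
Proof.
by have [N fN] := laurent_bounded f; exists N => i Ni; rewrite fN//; case: ifP.
Qed.

(* The polynomial part, seen in the field of Laurent series. *)
Definition polypart f : laurent F := Laurent (polypart_subproof f).

Lemma fracpart_subproof f : laurent_abs (f - polypart f) < 1.
Proof.
by apply/laurent_abs_lt1P => i i0; rewrite coeflD coeflN /= i0 subrr.
Qed.

End LaurentField.

Section Disc.
Variable F : finFieldType.

Definition disc := {f : laurent F | laurent_abs f < 1}.

HB.instance Definition _ := [isSub of disc for @sval _ _].
HB.instance Definition _ := [Choice of disc by <:].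

Let disc0_subproof : laurent_abs (0 : laurent F) < 1.
Proof. by rewrite laurent_abs0. Qed.

HB.instance Definition _ := isPointed.Build disc (exist _ 0 disc0_subproof).

HB.instance Definition _ := Measurable.copy disc
  (g_sigma_algebra_preimageType (\val : disc -> laurent F)).

Definition fracpart (f : laurent F) : disc := exist _ (f - polypart f) (fracpart_subproof f).

Lemma open_disc : open [set f : laurent F | laurent_abs f < 1].
Proof.
rewrite openE => f /= f1; rewrite /interior -nbhs_ballE; exists 1 => //= g.
rewrite /ball/= /laurent_ball => fg; rewrite -(subrK f g).
apply: le_lt_trans (laurent_absD _ _) _; rewrite gt_max f1 andbT.
by rewrite -opprB laurent_absN.
Qed.

Lemma measurable_val_disc (E : set disc) : measurable E ->
  measurable (\val @` E : set (laurent F)).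
Proof.
move=> [B mB <-]; rewrite setTI.
have -> : \val @` (\val @^-1` B : set disc) =
    B `&` [set f : laurent F | laurent_abs f < 1].
  apply/seteqP; split => [_ [f Bf <-]|f [Bf f1]].
    by split => //=; exact: (valP f).
  by exists (exist _ f f1).
apply: measurableI => //; apply: sub_sigma_algebra; exact: open_disc.
Qed.

End Disc.

HB.instance Definition _ := isPointed.Build int 0.
HB.instance Definition _ := @isMeasurable.Build default_measure_display
  int discrete_measurable discrete_measurable0
  discrete_measurableC discrete_measurableU.

(* Since elements of [disc F] have degree at most [-1], the condition of
   the second branch is [deg f = -1] and [0 <= n]. *)
Definition farey (F : finFieldType) (x : disc F * int) : disc F * int :=
  let: (f, n) := x in
  let t := laurentX F in
  if (laurent_deg (\val f) < (-1)%:E)%E || (n < 0)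
  then (fracpart (t * \val f), n + 1)
  else (fracpart (t * \val f)^-1, - (n + 1)).

Lemma laurent_deg_disc (F : finFieldType) (f : disc F) :
  (laurent_deg (\val f) <= (-1)%:E)%E.
Proof.
case: f => f /= /laurent_abs_lt1P f1.
have [->|f0] := eqVneq f 0; first by rewrite laurent_deg0 leNye.
have [n [fn nP]] := laurent_top f0.
have /laurent_degP -> : f n != 0 /\ forall i, n < i -> f i = 0 by [].
rewrite lee_fin; have [n0|] := leP 0 n; last by lia.
by rewrite f1 ?eqxx in fn.
Qed.

Section FareyMeasure.
Variables (R : realType) (F : finFieldType).
Local Notation K := (laurent F).
Local Notation q := (#|F|%:R : R).

Definition farey_weight (n : int) : R :=
  if 0 <= n then (q - 1) / (2 * q ^ n) else (q - 1) / (2 * q ^ (- n - 1)).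

Lemma farey_weight_ge0 n : 0 <= farey_weight n.
Proof.
have q1 : 0 <= q - 1 by rewrite subr_ge0 ler1n ltnW// card_finNzRing_gt1.
by rewrite /farey_weight; case: ifP => _; rewrite divr_ge0// mulr_ge0// exprz_ge0.
Qed.

Section def.
Variable mu : {measure set K -> \bar R}.

Definition farey_measure (A : set (disc F * int)) : \bar R :=
  \esum_(n in [set: int]) ((farey_weight n)%:E * mu (\val @` ysection A n))%E.

Let ge0 A : (0 <= farey_measure A)%E.
Proof. by apply: esum_ge0 => n _; rewrite mule_ge0// lee_fin farey_weight_ge0. Qed.

Let m0 : farey_measure set0 = 0%E.
Proof.
by apply: esum1 => n _; rewrite ysection0 image_set0 measure0 mule0.
Qed.

Let sadd : semi_sigma_additive farey_measure.
Proof.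
move=> A mA tA mUA.
rewrite [X in _ --> X](_ : _ = (\sum_(0 <= k <oo) farey_measure (A k))%E).
  exact: is_cvg_ereal_nneg_natsum.
rewrite nneseries_esumT// /farey_measure.
transitivity (\esum_(n in [set: int]) \esum_(k in [set: nat])
   ((farey_weight n)%:E * mu (\val @` ysection (A k) n))%E)%E.
  apply: eq_esum => n _; rewrite ysection_bigcup image_bigcup.
  rewrite measure_bigcup//; last 2 first.
    by move=> k _; apply: measurable_val_disc; exact: measurable_ysection.
    apply/trivIsetP => i j _ _ ij; rewrite -subset0 => x [[f fi <-] [g gj]].
    move=> /val_inj gf; move: gj; rewrite gf => gj.
    move/trivIsetP: tA => /(_ i j Logic.I Logic.I ij) /seteqP[+ _].
    move=> /(_ (f, n)); apply; split.
    + by move: fi; rewrite /ysection/= inE.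
    + by move: gj; rewrite /ysection/= inE.
  rewrite -nneseries_esumT; last first.
    by move=> k; rewrite mule_ge0// lee_fin farey_weight_ge0.
  rewrite nneseriesZl// ?lee_fin ?farey_weight_ge0//.
  by congr (_ * _)%E; apply: eq_eseriesl => k; rewrite in_setT.
rewrite esum_esum; last by move=> *; rewrite mule_ge0// lee_fin farey_weight_ge0.
rewrite [RHS]esum_esum; last by move=> *; rewrite mule_ge0// lee_fin farey_weight_ge0.
rewrite (@reindex_esum R (nat * int)%type (int * nat)%type
  ([set: nat] `*`` (fun=> [set: int])) _ (fun x => (x.2, x.1)))//.
split => [[k n]//|[k n] [k' n'] _ _ [-> ->]//|[n k] _]; by exists (k, n).
Qed.

HB.instance Definition _ := isMeasure.Build _ _ _ farey_measure m0 ge0 sadd.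

(* [farey_measure] is the measure on [disc F * int] determined by its values on
   the sets [E `*` [set n]]. *)
Lemma farey_measureE (E : set (disc F)) (n : int) :
  farey_measure (E `*` [set n]) = ((farey_weight n)%:E * mu (\val @` E))%E.
Proof.
rewrite /farey_measure (esumID [set n])//; last first.
  by move=> k _; rewrite mule_ge0// lee_fin farey_weight_ge0.
rewrite setTI esum_set1; last by rewrite mule_ge0// lee_fin farey_weight_ge0.
rewrite esum1 ?adde0.
  by rewrite in_ysectionX// inE.
move=> k [_ /= /eqP kn]; rewrite notin_ysectionX ?image_set0 ?measure0 ?mule0//.
by apply/negP; rewrite inE => /= /eqP; rewrite (negbTE kn).
Qed.

End def.

(* Finiteness on compact sets of a Borel measure on [laurent F] entails its
   regularity, since [laurent F] is a separable locally compact metric space. *)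
Definition haar_measure (mu : {measure set K -> \bar R}) :=
  [/\ forall (f : K) (A : set K), measurable A -> mu (+%R f @` A) = mu A,
      forall C : set K, compact C -> (mu C < +oo)%E
    & forall U : set K, open U -> U !=set0 -> (0 < mu U)%E].

Definition normalized_haar_measure (mu : {measure set K -> \bar R}) :=
  haar_measure mu /\ mu [set f : K | laurent_abs f <= 1] = 1%E.

End FareyMeasure.

Section Ergodic.
Context d (T : measurableType d) (R : realType).
Variables (mu : {measure set T -> \bar R}) (f : T -> T).

Definition invariant_measure :=
  measurable_fun [set: T] f /\
  forall A, measurable A -> mu (f @^-1` A) = mu A.

Definition ergodic_measure :=
  forall A, measurable A -> f @^-1` A = A -> mu A = 0%E \/ mu (~` A) = 0%E.

End Ergodic.

(* Main.v *)
Require Import Defs.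
From HB Require Import structures.
From mathcomp Require Import all_boot all_order all_algebra.
From mathcomp Require Import all_classical all_reals all_analysis.
From mathcomp Require Import zify ring.

(* On the set of [(f, n)] with the coefficient [f (-1) = a] fixed, [farey] is a
   similarity of ratio [q] from a ball of radius [q ^ -1] onto the whole disc,
   and the new second component depends only on [a] and [n].  Haar measure
   scales accordingly under similarities, since Borel measures are determined by
   their values on balls.  Invariance is then a summation over [a] and [n].

   For ergodicity, let [A] be invariant, with slices [A_n].  The numbers
   [h n = mu A_n] satisfy [h n = h (n + 1)] for [n < 0] and
   [h n = h (n + 1) / q + (1 - 1 / q) * h (- (n + 1))] for [n >= 0], which forces
   [h] to be constant.  By induction on the radius, every [A_n] then has the same
   density in every ball of the disc, so [A_n] is independent of all Borel
   subsets of the disc, in particular of its own complement. *)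

Set Implicit Arguments.
Unset Strict Implicit.
Unset Printing Implicit Defensive.

Local Open Scope classical_set_scope.
Local Open Scope ring_scope.

Import Order.TTheory GRing.Theory Num.Theory.

(** * Finite and infinite sums of extended reals *)

Lemma sume_const {R : realType} {I : finType} (P : {pred I}) (x : \bar R) :
  (\sum_(i in P) x = #|P|%:R%:E * x)%E.
Proof. by rewrite mule_natl sumr_const. Qed.

(** The pairing puts together [k] and [- k - 1], to which [farey_weight] gives the same value. *)
Lemma esum_int {R : realType} (a : int -> \bar R) : (forall n, 0 <= a n)%E ->
  \esum_(n in [set: int]) a n = (\sum_(k <oo) (a (Posz k) + a (Negz k)))%E.
Proof.
move=> a0; rewrite nneseriesD//; rewrite (esumID (range Posz))//; congr (_ + _)%E.
  by rewrite setTI esum_image ?nneseries_esumT// => i j _ _ [].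
rewrite setTI (_ : ~` _ = range Negz).
  by rewrite esum_image ?nneseries_esumT// => i j _ _ [].
apply/seteqP; split => [[k|k] /=|_ [k _ <-] [j _]//]; last by exists k.
by move=> nk; exfalso; apply: nk; exists k.
Qed.

Lemma nneseries_recl0 {R : realType} (u : nat -> \bar R) : (forall k, 0 <= u k)%E ->
  (\sum_(k <oo) u k = u 0%N + \sum_(k <oo) u k.+1)%E.
Proof.
move=> u0; rewrite nneseries_recl//; congr (_ + _)%E.
by rewrite -nneseries_addn//; apply: eq_eseriesr => k _; rewrite addn1.
Qed.

(** * Ultrametric balls and the Borel sets they generate *)

Section Balls.
Context {F : finFieldType}.
Implicit Types (c f g h : laurent F) (k j : int).

(* The ball [|f - c| < q ^ k] *)
Definition lball c k : set (laurent F) := [set f | forall i, k <= i -> f i = c i].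

Lemma lball_eq c f k : lball c k f -> lball f k = lball c k.
Proof.
move=> cf; apply/seteqP; split => g gf i ki; first by rewrite gf// cf.
by rewrite gf// cf.
Qed.

Lemma lball_sym c f k : lball c k f -> lball f k c.
Proof. by move=> cf i ki; rewrite cf. Qed.

Lemma lball_trans f c g k : lball c k f -> lball f k g -> lball c k g.
Proof. by move=> cf fg i ki; rewrite fg// cf. Qed.

Lemma subset_lball c k j : j <= k -> lball c j `<=` lball c k.
Proof. by move=> jk f fc i ki; apply: fc; apply: le_trans ki. Qed.

Lemma lball_sub0 f c k : lball c k f <-> lball 0 k (f - c).
Proof.
split => fc i ki; first by rewrite coeflD coeflN fc// subrr.
by apply/eqP; rewrite -subr_eq0 -[_ - _]/((f - c) i) fc.
Qed.

Lemma lball0E k : lball 0 k = [set f | laurent_abs f < #|F|%:R ^ k].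
Proof. by apply/seteqP; split => f; move=> /laurent_abs_ltP. Qed.

Lemma lballE c k : lball c k = ball_ (@laurent_abs F) c (#|F|%:R ^ k).
Proof.
apply/seteqP; split => f /=.
  by move=> /lball_sym/lball_sub0; rewrite lball0E.
by move=> fc; apply/lball_sym/lball_sub0; rewrite lball0E.
Qed.

Lemma open_lball c k : open (lball c k).
Proof.
rewrite openE => f cf; rewrite /interior -nbhs_ballE.
have q0 : 0 < #|F|%:R ^ k :> rat.
  by rewrite exprz_gt0// ltr0n; apply: ltnW; exact: card_finNzRing_gt1.
exists (#|F|%:R ^ k) => //= g; rewrite -(lball_eq cf) lballE.
by [].
Qed.

Lemma measurable_lball c k : measurable (lball c k).
Proof. by apply: sub_sigma_algebra; exact: open_lball. Qed.

(** A common point serves as the centre of both balls, so balls that meet are nested. *)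
Lemma lballI c c' k k' : k <= k' ->
  lball c k `&` lball c' k' = set0 \/ lball c k `&` lball c' k' = lball c k.
Proof.
move=> kk'; have [[f [cf c'f]]|/set0P/negP/negPn/eqP->] :=
  pselect ((lball c k `&` lball c' k') !=set0); last by left.
right; apply/setIidPl; rewrite -(lball_eq cf) -(lball_eq c'f).
exact: subset_lball.
Qed.

Lemma open_lballP (U : set (laurent F)) f : open U -> U f ->
  exists k, lball f k `<=` U.
Proof.
rewrite openE => oU /oU; rewrite /interior -nbhs_ballE => -[e /= e0 eU].
have [n en] : exists n : nat, e^-1 < #|F|%:R ^+ n.
  exists (Num.bound e^-1); apply: lt_le_trans (archi_boundP _) _.
    by rewrite invr_ge0 ltW.
  rewrite -natrX ler_nat; apply: ltnW; apply: ltn_expl.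
  exact: card_finNzRing_gt1.
exists (- n%:Z); rewrite lballE => g gf; apply: eU; apply: lt_trans gf _.
rewrite -exprnN; rewrite -(invrK e) ltf_pV2 ?posrE ?invr_gt0//.
by apply: lt_trans en; rewrite invr_gt0.
Qed.

Let finite_laurent_subproof k (s : seq F) :
  exists N : int, forall i : int, N < i ->
    (if k <= i then s`_`|i - k| else 0) = 0.
Proof.
exists (k + (size s)%:Z) => i ki; case: ifP => // ki'; apply: (@nth_default F).
by lia.
Qed.

(* The centres can be taken in the countable set of the [t ^ k * p] with [p] a
   polynomial, hence there are countably many balls. *)
Definition finite_laurent k (s : seq F) : laurent F :=
  Laurent (finite_laurent_subproof k s).

Lemma lball_finite_laurent c k : exists s, lball (finite_laurent k s) k = lball c k.
Proof.
have [N cN] := laurent_bounded c.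
pose m := (`|N|.+1 + `|k|)%N.
(* With this length, [k + m] exceeds [N], so all omitted coefficients of [c] are zero. *)
exists (mkseq (fun i => c (k + i%:Z)) m).
apply: lball_eq => i /= ki; rewrite ki.
have [im|mi] := ltnP (absz (i - k)) m.
  by rewrite nth_mkseq//; congr (c _); lia.
rewrite (@nth_default F) ?size_mkseq//.
by apply/esym/cN; rewrite /m in mi; lia.
Qed.

(** The empty set is included to make the family closed under intersection. *)
Definition lballs : set (set (laurent F)) :=
  [set lball c k | c in setT & k in setT] `|` [set set0].

Lemma lballs_lball c k : lballs (lball c k).
Proof. by left; exists c => //; exists k. Qed.

(** An open set is the union of the balls inside it, and the pairs [(k, s)] that index all balls
    form a countable type. *)
Lemma measurable_lballs : @measurable _ (laurent F) = <<s lballs >>.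
Proof.
apply/seteqP; split; last first.
  apply: smallest_sub; first exact: sigma_algebra_measurable.
  by move=> _ [[c _ [k _ <-]]|->]; [exact: measurable_lball|exact: measurable0].
apply: smallest_sub; first exact: smallest_sigma_algebra.
move=> U oU.
pose B (x : int * seq F) := lball (finite_laurent x.1 x.2) x.1.
have -> : U = \bigcup_x (if `[< B x `<=` U >] then B x else set0).
  apply/seteqP; split => [f Uf|f [x _]]; last by case: asboolP => // + ?; exact.
  have [k kU] := open_lballP oU Uf.
  have [s sk] := lball_finite_laurent f k.
  by exists (k, s) => //; rewrite /B/= sk; case: asboolP.
apply: (@countable_bigcupT_measurable _ (g_sigma_algebraType lballs)).
  exact: countableP.
move=> x; case: asboolP => _; last exact: measurable0.
by apply: (@sub_sigma_algebra _ setT lballs); exact: lballs_lball.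
Qed.

Lemma setI_closed_lballs : setI_closed lballs.
Proof.
move=> A B [[c _ [k _ <-]]|->]; last by rewrite set0I; right.
move=> [[c' _ [k' _ <-]]|->]; last by rewrite setI0; right.
wlog kk' : c c' k k' / k <= k' => [h|].
  by have [|/ltW] := leP k k'; [exact: h|rewrite setIC; exact: h].
by have [->|->] := lballI c c' kk'; [right|exact: lballs_lball].
Qed.

Lemma bigcup_lball : \bigcup_n lball 0 n%:Z = setT.
Proof.
apply/seteqP; split => // f _; have [N fN] := laurent_bounded f.
by exists `|N|.+1 => // i Ni; rewrite fN//; lia.
Qed.

Let monomial_subproof (a : F) k :
  exists N, forall i, N < i -> (if i == k then a else 0) = 0.
Proof. by exists k => i ki; rewrite gt_eqF. Qed.

Definition monomial a k := Laurent (monomial_subproof a k).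

Lemma lball_monomial a k f :
  lball (monomial a k) k f <-> lball 0 (k + 1) f /\ f k = a.
Proof.
split => [fa|[f0 <-] i ki /=].
  split; last by rewrite fa//= eqxx.
  by move=> i ki; rewrite fa/=; [rewrite gt_eqF//|]; lia.
case: eqVneq => [->//|ik]; rewrite f0//; lia.
Qed.

(** * Borel measures determined by their values on balls *)

Section Measures.
Context {R : realType}.
Implicit Types (m : {measure set (laurent F) -> \bar R}) (E : set (laurent F)).

(** Restricted to [lball c k], both measures agree on an intersection-stable generating family, and
    finiteness of [m1] there lets the uniqueness theorem apply. *)
Lemma eq_measure_lball m1 m2 c k : (m1 (lball c k) < +oo)%E ->
  (forall f j, lball c k f -> j <= k -> m1 (lball f j) = m2 (lball f j)) ->
  forall E, measurable E -> m1 (E `&` lball c k) = m2 (E `&` lball c k).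
Proof.
move=> m1oo m12 E mE; have mB := measurable_lball c k.
pose m1' : {measure set (laurent F) -> \bar R} := mrestr m1 mB.
pose m2' : {measure set (laurent F) -> \bar R} := mrestr m2 mB.
suff: m1' E = m2' E by [].
apply: (measure_unique lballs (fun n => lball 0 n%:Z)) => //.
- exact: measurable_lballs.
- exact: setI_closed_lballs.
- by move=> n; exact: lballs_lball.
- exact: bigcup_lball.
- move=> _ [[f _ [j _ <-]]|->]; last by rewrite !measure0.
  change (m1 (lball f j `&` lball c k) = m2 (lball f j `&` lball c k)).
  (* A ball meets [lball c k] in the empty set, in itself, or in all of [lball c k]. *)
  have [jk|/ltW kj] := leP j k.
    have [[g [fg cg]]|/set0P/negP/negPn/eqP->] :=
        pselect ((lball f j `&` lball c k) !=set0); last by rewrite !measure0.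
    have [->|->] := lballI f c jk; rewrite ?measure0//.
    by rewrite -(lball_eq fg) m12.
  rewrite setIC; have [->|->] := lballI c f kj; rewrite ?measure0//.
  exact: m12.
- move=> n; apply: le_lt_trans m1oo.
  change (m1 (lball 0%R n `&` lball c k) <= m1 (lball c k))%E.
  apply: le_measure; rewrite ?inE; last exact: subIsetr.
    by apply: measurableI; exact: measurable_lball.
  exact: measurable_lball.
Qed.

Lemma measure_lball_split m E k :
  measurable E ->
  m (E `&` lball 0 (k + 1)) = (\sum_(a : F) m (E `&` lball (monomial a k) k))%E.
Proof.
move=> mE.
rewrite (fsbig_seq _ _ (index_enum_uniq F)).
rewrite -measure_fin_bigcup//; last 2 first.
- apply/trivIsetP => a b _ _ ab; rewrite -subset0 => f [[_ fa] [_ fb]].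
  move/lball_monomial: fa => [_ fa]; move/lball_monomial: fb => [_ fb].
  by rewrite -fa fb eqxx in ab.
- by move=> a _; apply: measurableI => //; exact: measurable_lball.
congr (m _); apply/seteqP; split => [f [Ef f0]|f [a _ [Ef fa]]].
  by exists (f k); [exact: mem_index_enum|split => //; exact/lball_monomial].
by split => //; move/lball_monomial : fa => [].
Qed.

End Measures.
End Balls.

(** * Similarities between balls *)

Section Similarity.
Context {F : finFieldType}.
Implicit Types (c f g h : laurent F) (k j : int) (phi psi : laurent F -> laurent F).

(* [phi] maps the first ball onto the second one and multiplies distances by
   [q ^ (k' - k)]. *)
Definition ball_similarity phi c k c' k' :=
  [/\ lball c k `<=` phi @^-1` lball c' k',
      lball c' k' `<=` phi @` lball c k
    & forall f g j, lball c k f -> lball c k g -> j <= k ->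
        lball f j g <-> lball (phi f) (j + (k' - k)) (phi g)].

Lemma ball_similarity_comp phi psi c k c' k' c'' k'' :
  ball_similarity phi c k c' k' -> ball_similarity psi c' k' c'' k'' ->
  ball_similarity (psi \o phi) c k c'' k''.
Proof.
move=> [phi1 phi2 phi3] [psi1 psi2 psi3]; split.
- by move=> f /phi1/psi1.
- by move=> h /psi2[g /phi2[f fc <-] <-]; exists f.
- move=> f g j fc gc jk; rewrite phi3//.
  rewrite psi3; [|exact: phi1|exact: phi1|by lia].
  by rewrite (_ : j + (k' - k) + (k'' - k') = j + (k'' - k)); last by lia.
Qed.

Section measurable.
Variables (phi : laurent F -> laurent F) (c c' : laurent F) (k k' : int).
Hypothesis phiP : ball_similarity phi c k c' k'.

Lemma ball_similarity_preimage f j : lball c k f -> j <= k ->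
  lball c k `&` phi @^-1` lball (phi f) (j + (k' - k)) = lball f j.
Proof.
move=> cf jk; have [_ _ phi3] := phiP; apply/seteqP; split => g.
  by move=> [cg /=]; rewrite -phi3.
move=> fg; have cg : lball c k g.
  by apply: lball_trans cf _; exact: subset_lball fg.
by split => //=; rewrite -phi3.
Qed.

Lemma ball_similarity_measurable_fun : measurable_fun (lball c k) phi.
Proof.
apply: (@measurability _ _ _ _ _ _ lballs); first exact: measurable_lballs.
move=> _ [_ [[f _ [j _ <-]]|->] <-]; last first.
  by rewrite preimage_set0 setI0; exact: measurable0.
have [phi1 phi2 _] := phiP.
have [[g [cg fg]]|/set0P/negP/negPn/eqP->] := pselect
  ((lball c k `&` phi @^-1` lball f j) !=set0); last exact: measurable0.
(* A target ball at least as large as the image contains all of it; a smaller one is recentred at an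
   image point, and its preimage is again a ball. *)
have [kj|/ltW jk] := leP k' j.
  rewrite (_ : _ `&` _ = lball c k); first exact: measurable_lball.
  apply/setIidPl => h ch /=; rewrite -(lball_eq fg).
  by apply: subset_lball kj _ _; rewrite (lball_eq (phi1 _ cg)); exact: phi1.
rewrite -(lball_eq fg) (_ : j = j - (k' - k) + (k' - k)); last by lia.
by rewrite ball_similarity_preimage//; [exact: measurable_lball|lia].
Qed.

End measurable.
End Similarity.

(** * Haar measure of balls and its scaling under similarities *)

Section HaarMeasure.
Context {R : realType} {F : finFieldType} (mu : {measure set (laurent F) -> \bar R}).
Hypothesis hmu : normalized_haar_measure mu.
Implicit Types (c f g h : laurent F) (k j : int) (E : set (laurent F)).
Local Notation q := (#|F|%:R : R).

Let q_gt0 : 0 < q.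
Proof. by rewrite ltr0n; apply: ltnW; exact: card_finNzRing_gt1. Qed.

Let haar_lball0 c k : mu (lball c k) = mu (lball 0 k).
Proof.
have [[addmu _ _] _] := hmu.
rewrite -(addmu c (lball 0 k)); last exact: measurable_lball.
congr (mu _); apply/seteqP; split => [f cf|_ [f f0 <-]].
  by exists (f - c); [move/lball_sub0: cf|rewrite addrC subrK].
by apply/lball_sub0; rewrite addrC addKr.
Qed.

Let haar_lballS k : mu (lball 0%R (k + 1)%R) = (q%:E * mu (lball 0%R k))%E.
Proof.
rewrite -[X in mu X]setTI measure_lball_split; last exact: measurableT.
under eq_bigr do rewrite setTI haar_lball0.
by rewrite sume_const.
Qed.

Let haar_lball_pred k : mu (lball 0 k) = (q^-1%:E * mu (lball 0%R (k + 1)%R))%E.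
Proof. by rewrite haar_lballS muleA -EFinM mulVf ?gt_eqF// mul1e. Qed.

(** The exponent is [k - 1] because balls are open: the closed unit ball, of measure 1, is
    [lball 0 1]. Each ball consists of [q] translates of the next smaller one. *)
Lemma haar_lball c k : mu (lball c k) = (q ^ (k - 1))%:E.
Proof.
rewrite haar_lball0.
have mu1 : mu (lball 0 1) = 1%E.
  have [_ <-] := hmu; congr (mu _); apply/seteqP; split => f.
    by move=> f1; apply/(laurent_abs_leP f 0) => i i1; apply: f1; lia.
  by move=> /(laurent_abs_leP f 0) f1 i i1; apply: f1; lia.
have pos (n : nat) : mu (lball 0 (1 + n%:Z)) = (q ^ n%:Z)%:E.
  elim: n => [//|n ih].
  rewrite (_ : _ + _ = 1 + n%:Z + 1); last by lia.
  by rewrite haar_lballS ih -EFinM exprSz.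
have neg (n : nat) : mu (lball 0 (1 - n%:Z)) = (q ^ (- n%:Z))%:E.
  elim: n => [//|n ih].
  rewrite haar_lball_pred (_ : _ + 1 = 1 - n%:Z); last by lia.
  by rewrite ih -EFinM -!exprnN exprS invfM.
have [k1|k1] := leP 1 k.
  by rewrite (_ : k - 1 = `|k - 1|%N) -?pos; [congr (mu (lball _ _))|]; lia.
by rewrite (_ : k - 1 = - `|k - 1|%N%:Z) -?neg; [congr (mu (lball _ _))|]; lia.
Qed.

(** The pushforward of the restricted measure and the rescaled measure agree on balls inside
    [lball c' k'], since preimages of these are balls with radius scaled by [q ^ (k - k')]. *)
Lemma ball_similarity_haar phi c k c' k' E : ball_similarity phi c k c' k' ->
  measurable E ->
  mu (lball c k `&` phi @^-1` E) = ((q ^ (k - k')%R)%:E * mu (E `&` lball c' k'))%E.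
Proof.
move=> phiP mE; have [phi1 phi2 _] := phiP.
have mB := measurable_lball c k; have mB' := measurable_lball c' k'.
(* Only the restriction of [phi] to the ball is known to be measurable, so it is extended by a
   constant before the pushforward is formed. *)
pose psi := phi \_ (lball c k).
have mpsi : measurable_fun setT psi.
  exact: (measurable_restrictT phi mB).1 (ball_similarity_measurable_fun phiP).
have q_ge0 : 0 <= q ^ (k - k') by rewrite exprz_ge0// ltW.
pose m1 : {measure set (laurent F) -> \bar R} :=
  measure_function_pushforward__canonical__measure_function_Measure
    (mrestr mu mB) mpsi.
pose m2 : {measure set (laurent F) -> \bar R} := mscale (NngNum q_ge0) mu.
have m1E A : m1 A = mu (lball c k `&` phi @^-1` A).
  rewrite /m1/= /pushforward /mrestr/= setIC; congr (mu _).
  by apply/seteqP; split => f [cf]; rewrite /psi /= patchE mem_set.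
suff m12 : m1 (E `&` lball c' k') = m2 (E `&` lball c' k').
  rewrite -[RHS]/(m2 (E `&` lball c' k')) -m12 m1E; congr (mu _).
  apply/seteqP; split => f [cf]; last by case.
  by move=> Ef; split => //; split => //; exact: phi1.
apply: eq_measure_lball => //.
  rewrite m1E (_ : _ `&` _ = lball c k) ?haar_lball ?ltry//.
  exact/setIidPl.
move=> g j cg jk'; have [f cf <-] : (phi @` lball c k) g.
  by apply: phi2.
have kj : j - (k' - k) <= k by lia.
rewrite m1E.
have -> : lball (phi f) j = lball (phi f) (j - (k' - k) + (k' - k)).
  by congr lball; lia.
rewrite (ball_similarity_preimage phiP)//.
change (mu (lball f (j - (k' - k))%R) =
  ((q ^ (k - k')%R)%:E * mu (lball (phi f) (j - (k' - k) + (k' - k))%R))%E).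
rewrite !haar_lball -EFinM -expfzDr ?gt_eqF//.
by congr (_ ^ _)%:E; lia.
Qed.

End HaarMeasure.

(** * The branches of the Farey map as similarities *)

Section Branches.
Context {F : finFieldType}.
Implicit Types (f g h u v : laurent F) (i j k : int) (a : F).

Lemma coefl_mulX f k : (laurentX F * f) k = f (k - 1).
Proof.
rewrite coeflM (@fsbigE _ _ _ _ _ [:: 1])//.
- by rewrite big_cons big_nil in_setT /= mul1r; exact: addr0.
- by move=> i _; rewrite inE /= => /negbTE ->; rewrite mul0r.
Qed.

Lemma laurentX_neq0 : laurentX F != 0.
Proof.
by apply/eqP => /(congr1 (fun f => coefl f 1)) /= /eqP; rewrite oner_eq0.
Qed.

Lemma coefl_mulVX f k : ((laurentX F)^-1 * f) k = f (k + 1).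
Proof.
by rewrite -[in RHS](mulVKf laurentX_neq0 f) coefl_mulX addrK.
Qed.

Lemma ball_similarity_mulX a k :
  ball_similarity (fun f => laurentX F * f)
    (monomial a k) k (monomial a (k + 1)) (k + 1).
Proof.
split.
- by move=> f fa i ki; rewrite coefl_mulX fa/= ?(can2_eq (subrK _) (addrK _))//; lia.
- move=> g ga; exists ((laurentX F)^-1 * g); last by rewrite mulVKf// laurentX_neq0.
  move=> i ki; rewrite coefl_mulVX ga/=; last by lia.
  by rewrite (inj_eq (addIr 1)).
- move=> f g j _ _ _; split => fg i ji.
    by rewrite !coefl_mulX fg//; lia.
  have := fg (i + 1); rewrite !coefl_mulX addrK; apply; lia.
Qed.

Lemma coefl_fracpart f i : (\val (fracpart f)) i = if 0 <= i then 0 else f i.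
Proof.
rewrite -[\val _]/(f - polypart f) coeflD coeflN /=.
by case: ifP; rewrite ?subrr// subr0.
Qed.

(** The polynomial part is constant on a ball of radius 1, so [fracpart] is a translation there. *)
Lemma ball_similarity_fracpart c :
  ball_similarity (fun f => \val (fracpart f)) c 0 0 0.
Proof.
split.
- by move=> f fc i ki; rewrite coefl_fracpart ki.
- move=> g g0; exists (g + polypart c).
    by move=> i i0; rewrite coeflD g0//= i0 add0r.
  apply: laurentP => i; rewrite coefl_fracpart coeflD/=.
  case: ifP => i0; first by rewrite g0.
  by rewrite i0 addr0.
- move=> f g j fc gc j0; split => fg i ji; rewrite ?coefl_fracpart.
    by rewrite fg//; lia.
  have [i0|i0] := leP 0 i; first by rewrite fc// gc.
  by have := fg i; rewrite !coefl_fracpart [0 <= i]leNgt i0/=; apply; lia.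
Qed.

Let mul_bounded f g i j : (forall k, i < k -> f k = 0) -> (forall k, j < k -> g k = 0) ->
  forall k, i + j < k -> (f * g) k = 0.
Proof. by move=> fi gj; exact: laurent_conv_bnd fi gj. Qed.

(** The leading term of [u^-1 * u] is the product of the leading terms. As the product is 1 and [u]
    has degree 0, [u^-1] has degree 0 and leading coefficient [a^-1]. *)
Lemma lball_monomial_inv a u : a != 0 ->
  lball (monomial a 0) 0 u -> lball (monomial a^-1 0) 0 u^-1.
Proof.
move=> a0 /lball_monomial[u1 u0].
have unz : u != 0.
  by apply: contra_neq a0 => u00; rewrite -u0 u00.
have u1' i : 0 < i -> u i = 0 by move=> i0; rewrite u1//; lia.
have [n [un nP]] : exists n, u^-1 n != 0 /\ forall i, n < i -> u^-1 i = 0.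
  by apply: laurent_top; rewrite invr_eq0.
have top : (u^-1 * u) n = u^-1 n * a.
  have := laurent_convE 0 nP u1'; rewrite addr0 subr0 big_ord_recl big_ord0/=.
  by rewrite !subr0 u0 addr0.
move: top; rewrite mulVf//= => top.
have n0 : n = 0.
  by apply/eqP; apply: contraTT un => /negbTE n0; apply/negPn/eqP;
    move/eqP: top; rewrite n0 eq_sym mulf_eq0 (negbTE a0) orbF => /eqP.
move: top nP; rewrite n0 eqxx => top nP; apply/lball_monomial; split.
  by move=> i i1; rewrite nP//; lia.
by apply: (mulIf a0); rewrite -top mulVf.
Qed.

(** The difference of the inverses is [(u - v) / (u * v)], and both inverses have degree 0. *)
Let lball_inv a u v j : a != 0 -> lball (monomial a 0) 0 u ->
  lball (monomial a 0) 0 v -> lball u j v -> lball u^-1 j v^-1.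
Proof.
move=> a0 ua va uv.
have bnd0 b w : lball (monomial b 0) 0 w -> forall k, 0 < k -> w k = 0.
  by move=> /lball_monomial[w1 _] k k0; rewrite w1//; lia.
have nz w : lball (monomial a 0) 0 w -> w != 0.
  by move=> /lball_monomial[_ w0]; apply: contra_neq a0 => w00; rewrite -w0 w00.
apply/lball_sub0.
have -> : v^-1 - u^-1 = (u - v) * (u^-1 * v^-1).
  by field; rewrite !nz.
move=> i ji.
(* Agreement from index [j] on means that [u - v] has degree at most [j - 1]. *)
apply: (@mul_bounded _ _ (j - 1) (0 + 0)); last by lia.
  move=> k jk; have /lball_sub0 := lball_sym uv; apply; lia.
apply: mul_bounded => k k0.
  by have /bnd0 -> := lball_monomial_inv a0 ua.
by have /bnd0 -> := lball_monomial_inv a0 va.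
Qed.

(** Inversion is an involution, so the converse directions follow from the direct ones for
    [a^-1]. *)
Lemma ball_similarity_inv a : a != 0 ->
  ball_similarity (@GRing.inv (laurent F)) (monomial a 0) 0 (monomial a^-1 0) 0.
Proof.
move=> a0; have ai0 : a^-1 != 0 by rewrite invr_eq0.
split.
- by move=> f; exact: lball_monomial_inv.
- move=> g ga; exists g^-1; last exact: invrK.
  by rewrite -[a]invrK; exact: lball_monomial_inv.
- move=> f g j fa ga j0; rewrite subrr addr0; split; first exact: lball_inv a0 _ _.
  move=> /(lball_inv ai0); rewrite !invrK; apply; exact: lball_monomial_inv.
Qed.

(* The branch of [farey] on the elements with [t ^ -1]-coefficient [a] and
   second component [n]. *)
Definition farey_shift a (n : int) := (a == 0) || (n < 0).

Definition farey_branch a n f : laurent F :=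
  \val (fracpart (if farey_shift a n then laurentX F * f else (laurentX F * f)^-1)).

Definition farey_target a (n : int) : int :=
  if farey_shift a n then n + 1 else - (n + 1).

(** Multiplication by [t] enlarges the ball to radius 1; inversion, for [a] nonzero, and [fracpart]
    then preserve distances. *)
Lemma ball_similarity_farey_branch a n :
  ball_similarity (farey_branch a n) (monomial a (-1)) (-1) 0 0.
Proof.
have X := ball_similarity_mulX a (-1); rewrite /farey_branch.
case: (boolP (farey_shift a n)) => [_|].
  exact: ball_similarity_comp X (ball_similarity_fracpart _).
rewrite /farey_shift negb_or => /andP[a0 _].
apply: ball_similarity_comp (ball_similarity_fracpart _).
exact: ball_similarity_comp X (ball_similarity_inv a0).
Qed.

(** Degrees in the disc are at most -1, so the test for degree below -1 amounts to [a == 0]. *)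
Lemma fareyE a n (f : disc F) : lball (monomial a (-1)) (-1) (\val f) ->
  farey (f, n) = (fracpart (if farey_shift a n then laurentX F * \val f
                            else (laurentX F * \val f)^-1), farey_target a n).
Proof.
move=> fa; rewrite /farey /farey_target /farey_shift.
have -> : (laurent_deg (\val f) < (-1)%:E)%E = (a == 0).
  rewrite lt_neqAle laurent_deg_disc andbT; apply/idP/idP.
    apply: contraR => a0; apply/eqP/laurent_degP.
    by rewrite fa//=; split => // i i1; rewrite fa/= ?gt_eqF//; lia.
  move=> a0; apply/eqP => /laurent_degP[+ _].
  by rewrite fa//= (eqP a0) eqxx.
by case: ifP.
Qed.

End Branches.

(** * Measurability of the map and the measures of slices of preimages *)

Section Farey.
Context {R : realType} {F : finFieldType} (mu : {measure set (laurent F) -> \bar R}).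
Hypothesis hmu : normalized_haar_measure mu.
Implicit Types (f g h : laurent F) (n : int) (a : F) (A B : set (disc F * int)).
Local Notation q := (#|F|%:R : R).
Local Notation fbranch := (@farey_branch F).

Let q_gt1 : 1 < q.
Proof. by rewrite ltr1n card_finNzRing_gt1. Qed.

Let q_gt0 : 0 < q.
Proof. exact: lt_trans q_gt1. Qed.

Definition slice A n : set (laurent F) := \val @` ysection A n.

Lemma sliceP A n (f : disc F) : slice A n (\val f) <-> A (f, n).
Proof.
rewrite /slice; split => [[g gA /val_inj <-]|fA].
  by move: gA; rewrite /ysection/= inE.
by exists f => //; rewrite /ysection/= inE.
Qed.

Lemma slice_sub A n : slice A n `<=` lball 0 0.
Proof. by move=> _ [f _ <-]; rewrite lball0E; exact: (valP f). Qed.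

Lemma measurable_slice A n : measurable A -> measurable (slice A n).
Proof. by move=> mA; apply: measurable_val_disc; exact: measurable_ysection. Qed.

Lemma slice_preimage A n a :
  slice (@farey F @^-1` A) n `&` lball (monomial a (-1)) (-1) =
  lball (monomial a (-1)) (-1) `&` fbranch a n @^-1` slice A (farey_target a n).
Proof.
apply/seteqP; split => [_ [[f fA <-] fa]|f [fa fA]].
  split => //; have : A (farey (f, n)).
    by apply/(sliceP (@farey F @^-1` A)); exists f.
  by rewrite (fareyE n fa) => /sliceP.
split => //; have f1 : laurent_abs f < 1.
  have : lball 0 0 f by move/lball_monomial : fa => [].
  by rewrite lball0E.
pose f' : disc F := exist _ f f1.
apply/(sliceP _ _ f'); suff : A (farey (f', n)) by [].
by rewrite (fareyE n (f := f') fa); apply/sliceP.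
Qed.

Lemma measurable_farey : measurable_fun setT (@farey F).
Proof.
move=> _ A mA; rewrite setTI.
(* The piece indexed by [(n, a)] collects the points of the preimage with second component [n] and
   [t ^ -1]-coefficient [a]; there are countably many pieces. *)
pose C (x : int * F) := (\val @^-1` (lball (monomial x.2 (-1)) (-1) `&`
  fbranch x.2 x.1 @^-1` slice A (farey_target x.2 x.1)) : set (disc F)) `*` [set x.1].
have -> : @farey F @^-1` A = \bigcup_x C x.
  apply/seteqP; split => [[f n] Af|[f n] [[m a] _ []/=]].
    have /sliceP Af' : (@farey F @^-1` A) (f, n) by [].
    pose a := (\val f) (-1).
    have : (slice (@farey F @^-1` A) n `&` lball (monomial a (-1)) (-1)) (\val f).
      by split => //; apply/lball_monomial; split => //; exact: slice_sub Af'.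
    by rewrite slice_preimage => Cf; exists (n, a).
  move=> Cf ->; have : (slice (@farey F @^-1` A) m `&` lball (monomial a (-1)) (-1)) (\val f).
    by rewrite slice_preimage.
  by move=> [/sliceP].
apply: countable_bigcupT_measurable; first exact: countableP.
move=> [n a]; apply: measurableX => //=.
exists (lball (monomial a (-1)) (-1) `&`
  fbranch a n @^-1` slice A (farey_target a n)); last by rewrite setTI.
apply: (ball_similarity_measurable_fun (ball_similarity_farey_branch a n)).
  exact: measurable_lball.
exact: measurable_slice.
Qed.

Let measurable_preimage_farey A : measurable A -> measurable (@farey F @^-1` A).
Proof. by move=> mA; rewrite -[_ @^-1` _]setTI; exact: measurable_farey. Qed.

Lemma haar_slice_preimage_lball A n a f j : measurable A ->
  lball (monomial a (-1)) (-1) f -> j <= -1 ->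
  mu (slice (@farey F @^-1` A) n `&` lball f j) =
  (q^-1%:E * mu (slice A (farey_target a n) `&` lball (fbranch a n f) (j + 1)%R))%E.
Proof.
move=> mA fa j1; have brP := ball_similarity_farey_branch a n.
have mE : measurable (slice A (farey_target a n) `&` lball (fbranch a n f) (j + 1)).
  by apply: measurableI; [exact: measurable_slice|exact: measurable_lball].
have := ball_similarity_haar hmu brP mE.
have -> : lball (monomial a (-1)) (-1) `&` fbranch a n @^-1`
    (slice A (farey_target a n) `&` lball (fbranch a n f) (j + 1)) =
    slice (@farey F @^-1` A) n `&` lball f j.
  rewrite preimage_setI setIA -slice_preimage -setIA.
  by rewrite -(ball_similarity_preimage brP fa j1).
move=> ->; congr (_ * mu _)%E; apply/setIidPl => g [+ _]; exact: slice_sub.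
Qed.

Lemma haar_slice_preimage A n : measurable A ->
  mu (slice (@farey F @^-1` A) n) =
  (\sum_(a : F) q^-1%:E * mu (slice A (farey_target a n)))%E.
Proof.
move=> mA; have mA' := measurable_slice n (measurable_preimage_farey mA).
rewrite -[in LHS](setIidl (@slice_sub (@farey F @^-1` A) n)).
rewrite (measure_lball_split mu (-1) mA'); apply: eq_bigr => a _.
rewrite slice_preimage.
rewrite (ball_similarity_haar hmu (ball_similarity_farey_branch a n)); last first.
  exact: measurable_slice.
by congr (_ * mu _)%E; apply/setIidl; exact: slice_sub.
Qed.

(** For a negative second component all [q] values of [a] lead to the same slice, each with factor
    [q^-1]. *)
Lemma haar_slice_preimage_neg A k : measurable A ->
  mu (slice (@farey F @^-1` A) (Negz k)) = mu (slice A (- k%:Z)).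
Proof.
move=> mA; rewrite haar_slice_preimage//.
rewrite (eq_bigr (fun=> q^-1%:E * mu (slice A (- k%:Z))))%E; last first.
  move=> a _; rewrite /farey_target /farey_shift orbT.
  by congr (_ * mu (slice A _))%E; lia.
by rewrite sume_const muleA -EFinM mulfV ?mul1e// gt_eqF.
Qed.

(** Only [a = 0] shifts to [k + 1]; the other [q - 1] values of [a] lead to [- (k + 1)], which is
    [Negz k]. *)
Lemma haar_slice_preimage_pos A k : measurable A ->
  mu (slice (@farey F @^-1` A) (Posz k)) =
  (q^-1%:E * mu (slice A (Posz k.+1)) + (1 - q^-1)%:E * mu (slice A (Negz k)))%E.
Proof.
move=> mA; rewrite haar_slice_preimage// (bigD1 0)//=; congr (_ + _)%E.
  rewrite /farey_target /farey_shift eqxx.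
  by congr (_ * mu (slice A _))%E; lia.
rewrite (eq_bigr (fun=> q^-1%:E * mu (slice A (Negz k))))%E; last first.
  move=> a a0; rewrite /farey_target /farey_shift (negbTE a0)/=.
  by congr (_ * mu (slice A _))%E; lia.
rewrite sume_const muleA -EFinM; congr (_%:E * _)%E.
rewrite cardC1 -subn1 natrB; last by apply: ltnW; exact: card_finNzRing_gt1.
by rewrite mulrBl mulfV ?gt_eqF// mul1r.
Qed.

(** * Invariance of the measure *)

Let weight k : R := (q - 1) / (2 * q ^+ k).

Let weight_ge0 k : 0 <= weight k.
Proof.
by rewrite divr_ge0 ?subr_ge0 ?(ltW q_gt1)// mulr_ge0// exprn_ge0// ltW.
Qed.

Let weightS k : weight k.+1 = weight k * q^-1.
Proof. by rewrite /weight exprSr mulrA invfM mulrA. Qed.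

Let farey_weight_pos k : farey_weight R F (Posz k) = weight k.
Proof. by []. Qed.

Let farey_weight_neg k : farey_weight R F (Negz k) = weight k.
Proof. by rewrite /farey_weight/= (_ : - Negz k - 1 = k%:Z)//; lia. Qed.

Lemma farey_measure_slice A :
  farey_measure mu A =
  (\sum_(k <oo) ((weight k)%:E * mu (slice A (Posz k)) +
                (weight k)%:E * mu (slice A (Negz k))))%E.
Proof.
rewrite /farey_measure esum_int; last first.
  by move=> n; rewrite mule_ge0// lee_fin farey_weight_ge0.
by apply: eq_eseriesr => k _; rewrite farey_weight_pos farey_weight_neg.
Qed.

Lemma farey_measure_preimage A : measurable A ->
  farey_measure mu (@farey F @^-1` A) = farey_measure mu A.
Proof.
move=> mA; rewrite !farey_measure_slice.
pose x n := mu (slice A n); have x0 n : (0 <= x n)%E by [].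
have w0 k : (0 <= (weight k)%:E)%E by rewrite lee_fin weight_ge0.
have dw0 k : (0 <= (weight k - weight k.+1)%:E)%E.
  by rewrite lee_fin subr_ge0 weightS ler_piMr// invf_le1 ?ltW.
(* [P] and [N] are the masses of [A] at [Posz k] and [Negz k]. In the preimage, level [Posz k]
   contributes [P k.+1] and [D k], and level [Negz k] contributes [Q k]. *)
pose P k := ((weight k)%:E * x (Posz k))%E.
pose N k := ((weight k)%:E * x (Negz k))%E.
pose D k := ((weight k - weight k.+1)%:E * x (Negz k))%E.
pose Q k := ((weight k)%:E * x (- k%:Z)%R)%E.
transitivity (\sum_(k <oo) (P k.+1 + D k + Q k))%E.
  apply: eq_eseriesr => k _.
  rewrite haar_slice_preimage_pos// haar_slice_preimage_neg//; congr (_ + _)%E.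
  rewrite ge0_muleDr; [|by rewrite mule_ge0// lee_fin invr_ge0 ltW|]; last first.
    by rewrite mule_ge0// lee_fin subr_ge0 invf_le1 ?ltW.
  by rewrite !muleA -!EFinM /P /D weightS mulrBr mulr1.
have P0 k : (0 <= P k)%E by rewrite mule_ge0.
have N0 k : (0 <= N k)%E by rewrite mule_ge0.
have D0 k : (0 <= D k)%E by rewrite mule_ge0.
have Q0 k : (0 <= Q k)%E by rewrite mule_ge0.
(* The slice at [Negz k] is reached from [Posz k] with weight [D] and from [Negz k.+1] with the
   remaining weight. *)
have NE : (\sum_(k <oo) N k = \sum_(k <oo) D k + \sum_(k <oo) Q k.+1)%E.
  rewrite -nneseriesD//; apply: eq_eseriesr => k _.
  rewrite -[Q _]/((weight k.+1)%:E * x (Negz k))%E.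
  by rewrite -ge0_muleDl// -EFinD subrK.
transitivity (\sum_(k <oo) P k + \sum_(k <oo) N k)%E; last by rewrite -nneseriesD.
rewrite nneseriesD//; last by move=> k *; rewrite adde_ge0.
rewrite nneseriesD// NE (nneseries_recl0 P0) (nneseries_recl0 Q0).
(* The leftover [Q 0] is [P 0] by computation. *)
by rewrite addeACA [(_ + Q 0%N)%E]addeC.
Qed.

(** * Ergodicity *)

Section Ergodicity.
Variable A : set (disc F * int).
Hypotheses (mA : measurable A) (invA : @farey F @^-1` A = A).

Let slice_le n : (mu (slice A n) <= (q^-1)%:E)%E.
Proof.
rewrite (_ : q^-1%:E = mu (lball 0%R 0)); last by rewrite haar_lball.
apply: le_measure; rewrite ?inE; last exact: slice_sub.
  exact: measurable_slice.
exact: measurable_lball.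
Qed.

Let slice_fin n : mu (slice A n) \is a fin_num.
Proof. by rewrite ge0_fin_numE//; apply: le_lt_trans (slice_le n) (ltry _). Qed.

Lemma haar_slice_invariant n : mu (slice A n) = mu (slice A 0).
Proof.
have neg k : mu (slice A (- k%:Z)) = mu (slice A 0).
  elim: k => [//|k <-]; rewrite -(haar_slice_preimage_neg k mA) invA.
  by congr (mu (slice A _)); lia.
case: n => k; last by rewrite -(neg k.+1).
elim: k => [//|k ih].
have := haar_slice_preimage_pos k mA; rewrite invA ih.
have -> : mu (slice A (Negz k)) = mu (slice A 0) by rewrite -(neg k.+1).
(* Cancellation in the recurrence takes place in the reals, as slices have finite measure. *)
rewrite -(fineK (slice_fin 0)) -(fineK (slice_fin k.+1)).
set x := fine (mu (slice A 0)); set y := fine _.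
rewrite -!EFinM -EFinD => -[xy]; congr _%:E; have q0 : q != 0 by rewrite gt_eqF.
have {}xy : q^-1 * (y - x) = x - x by rewrite {2}xy; ring.
by move/eqP: xy; rewrite subrr mulf_eq0 invr_eq0 (negbTE q0) subr_eq0 => /eqP.
Qed.

(** Each application of the map enlarges the ball by a factor [q] until it is the whole disc. The
    induction covers all [n] and [f], since a branch changes both. *)
Lemma haar_slice_lball n f (j : nat) : lball 0 0 f ->
  mu (slice A n `&` lball f (- j%:Z)) = ((q ^- j)%:E * mu (slice A 0))%E.
Proof.
elim: j n f => [|j ih] n f f0.
  rewrite oppr0 (lball_eq f0) (setIidl (@slice_sub A n)) expr0 invr1 mul1e.
  exact: haar_slice_invariant.
pose a := f (-1).
have fa : lball (monomial a (-1)) (-1) f by apply/lball_monomial.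
have [br _ _] := ball_similarity_farey_branch a n.
rewrite -{1}invA (haar_slice_preimage_lball n mA fa); last by lia.
rewrite (_ : _ + 1 = - j%:Z); last by lia.
by rewrite ih ?muleA -?EFinM -?invfM -?exprS//; exact: br.
Qed.

(** The factor [q * mu (slice A 0)] is the density of a slice in the disc, which has measure [q^-1].
    Equal densities in all balls extend to Borel sets. *)
Lemma haar_slice_indep n (E : set (laurent F)) : measurable E -> E `<=` lball 0 0 ->
  mu (E `&` slice A n) = (q%:E * mu (slice A 0) * mu E)%E.
Proof.
move=> mE E0; have mS := measurable_slice n mA.
pose h := fine (mu (slice A 0)).
have muh : mu (slice A 0) = h%:E by rewrite fineK.
have c0 : 0 <= q * h by rewrite mulr_ge0 ?fine_ge0// ltW.
rewrite muh -EFinM.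
pose m1 : {measure set (laurent F) -> \bar R} := mrestr mu mS.
pose m2 : {measure set (laurent F) -> \bar R} := mscale (NngNum c0) mu.
suff : m1 (E `&` lball 0 0) = m2 (E `&` lball 0 0) by rewrite setIidl.
apply: eq_measure_lball => //.
  rewrite /m1/= /mrestr; apply: le_lt_trans (ltry q^-1).
  by rewrite setIidr; [exact: slice_le|exact: slice_sub].
move=> f j f0 j0; have [k ->] : exists k : nat, j = - k%:Z.
  by exists (absz j); lia.
rewrite /m1/= /mrestr setIC haar_slice_lball//.
rewrite /m2/= /mscale/= haar_lball// muh -!EFinM; congr _%:E.
by rewrite mulrAC -opprD -exprnN addn1 exprS invfM mulVKf ?gt_eqF.
Qed.

Lemma farey_ergodic_set : farey_measure mu A = 0%E \/ farey_measure mu (~` A) = 0%E.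
Proof.
(* Independence is applied to the complementary slice, which is disjoint from [slice A n]: one of
   the two factors must vanish. *)
have indep n : (q%:E * mu (slice A 0) * mu (slice (~` A) n) = 0)%E.
  rewrite -(haar_slice_indep n); last exact: slice_sub; last first.
    by apply: measurable_slice; exact: measurableC.
  rewrite (_ : _ `&` _ = set0) ?measure0//; apply/seteqP; split => // _ [[f fA <-]].
  by move=> /sliceP Af; have /sliceP : slice (~` A) n (\val f) by exists f.
have [A0|A0] := eqVneq (mu (slice A 0)) 0%E; [left|right]; rewrite farey_measure_slice;
  apply: eseries0 => k _ _.
  by rewrite !haar_slice_invariant A0 !mule0 adde0.
have null n : mu (slice (~` A) n) = 0%E.
  by move/eqP: (indep n); rewrite !mule_eq0 (negbTE A0) eqe gt_eqF//= => /eqP.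
by rewrite !null !mule0 adde0.
Qed.

End Ergodicity.
End Farey.

Theorem theorem1 (R : realType) (F : finFieldType)
    (mu : {measure set (laurent F) -> \bar R})
    (hmu : normalized_haar_measure mu) :
  invariant_measure (farey_measure mu) (@farey F) /\
  ergodic_measure (farey_measure mu) (@farey F).
Proof.
split; last by move=> A; exact: farey_ergodic_set.
by split; [exact: measurable_farey|exact: farey_measure_preimage].
Qed.
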